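(* Let $k$ be an infinite topological field, and let $\mathfrak X=(X,\mathcal S)$ be a locally ringed superspace over $k$. Assume that the topological space $pt_1(\mathfrak X)$ (with the natural topology) is compact. Then the virtual topological superspace determined by $\mathfrak X$ is trivial in the odd sector.
   Context: ''Graded'' means $\mathbb Z/2$-graded; all algebras are associative and unital over the field $k$. A graded algebra $\Lambda=\Lambda_0\oplus\Lambda_1$ is graded commutative if $xy=(-1)^{\tilde x\tilde y}yx$ for homogeneous $x,y$ of parities $\tilde x,\tilde y$. A graded commutative algebra is local if it contains a unique maximal proper graded ideal; the quotient by this ideal is a field extension of $k$, called the residue field. $\wedge(q)$ denotes the Grassmann (exterior) algebra over $k$ on $q$ odd generators, graded by parity of degree. A locally ringed superspace over $k$ is a pair $\mathfrak X=(X,\mathcal S)$, where $X$ is a topological space and $\mathcal S$ is a sheaf of local graded commutative $k$-algebras on $X$, meaning that for every nonempty open $V\subseteq X$ the algebra $\mathcal S(V)$ is a local graded commutative algebra, and every stalk $\mathcal S_x$ is a local graded commutative algebra ($\mathcal S(\emptyset)=\{0\}$). A morphism $f=(f_0,f^\sharp)$ from $(X,\mathcal S_X)$ to $(Y,\mathcal S_Y)$ consists of a continuous map $f_0:X\to Y$ and a (grading-preserving) morphism of sheaves of unital $k$-algebras $f^\sharp:\mathcal S_Y\to f_{0,\ast}\mathcal S_X$ whose induced stalk homomorphisms $\mathcal S_{Y,f_0(x)}\to\mathcal S_{X,x}$ send the maximal graded ideal into the maximal graded ideal. $pt_q$ is the superspace whose underlying space is a singleton $\{\ast\}$ and whose algebra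 of global sections is $\wedge(q)$. A $q$-point of $\mathfrak X$ is a morphism $\varkappa:pt_q\to\mathfrak X$; the set of $q$-points is $pt_q(\mathfrak X)$. A $q$-point $\varkappa$ gives a graded algebra homomorphism $\varkappa^\sharp:\mathcal S_x\to\wedge(q)$, where $x=\varkappa_0(\ast)$. For $U\subseteq X$ open, $pt_q(U)$, the set of $q$-points of $(U,\mathcal S|_U)$, is naturally a subset of $pt_q(\mathfrak X)$. For $f\in\mathcal S(U)$ the map $f_q:pt_q(U)\to\wedge(q)$ sends $\varkappa$ to $\varkappa^\sharp$ of the germ of $f$ at $\varkappa_0(\ast)$. The natural topology on $pt_q(\mathfrak X)$ is the coarsest topology with the following property: for every open $U\subseteq X$ and every $f\in\mathcal S(U)$, the map $f_q:pt_q(U)\to\wedge(q)$ is continuous with respect to the subspace topology on $pt_q(U)$ and the standard product topology on $\wedge(q)$ as a finite-dimensional vector space over $k$. The virtual topological superspace determined by $\mathfrak X$ is the covariant functor $\wedge(q)\mapsto pt_q(\mathfrak X)$ (with natural topologies) from the category of finite-dimensional Grassmann algebras and grading-preserving unital homomorphisms to topological spaces, a homomorphism $\varphi:\wedge(q)\to\wedge(p)$ acting by $\varkappa\mapsto\varkappa\circ\varphi^\sharp$, where $\varphi^\sharp:pt_p\to pt_q$ is the morphism corresponding to $\varphi$. It is trivial in the odd sector if for every $q\in\mathbb N$ and every $\varkappa\in pt_q(\mathfrak X)$ the graded subalgebra $\varkappa^\sharp(\mathcal S_x)$ of $\wedge(q)$, $x=\varkappa_0(\ast)$, has trivial odd sector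 (zero odd part).
   Formalization: The topological field is assumed Hausdorff (for the indiscrete topology the claim fails, e.g. for a one-point superspace with algebra ∧(1)), and the natural topology is taken literally as the coarsest one, which need not exist for every superspace. *)

(* Defs.v *)
From HB Require Import structures.
From mathcomp Require Import all_boot all_order all_algebra.
From mathcomp Require Import all_classical topology tvs.
From mathcomp Require Import generic_quotient ring.

Set Implicit Arguments.
Unset Strict Implicit.
Unset Printing Implicit Defensive.

Import GRing.Theory.
Local Open Scope ring_scope.

(* Separation is part of the definition: a field topology is either Hausdorff
   or indiscrete, and only the former are called topological fields. *)
HB.mixin Record TopologicalZmodule_isTopologicalField K
    & TopologicalZmodule K & GRing.Field K := {
  mulf_continuous : continuous (fun x : K * K => x.1 * x.2) ;
  invf_continuous : forall x : K, x != 0 ->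
    {for x, continuous (@GRing.inv K : K -> K)} ;
  topfield_hausdorff : hausdorff_space K ;
}.

#[short(type="topologicalFieldType")]
HB.structure Definition TopologicalField :=
  {K of TopologicalZmodule K & GRing.Field K
        & TopologicalZmodule_isTopologicalField K}.

(* A graded k-algebra, given as a ring with a central structure map from k, so
   that c x is written [sconst c * x]; [homog b] is the component of parity [b],
   [true] being odd. Neither algType nor lalgType can be used: they exclude the
   zero algebra, which a sheaf takes as value on the empty set. *)
HB.mixin Record isSuperalgebra (k : fieldType) A & GRing.PzRing A := {
  sconst : {rmorphism k -> A} ;
  sconst_central : forall (c : k) (x : A), sconst c * x = x * sconst c ;
  homog : bool -> set A ;
  homog0 : forall b, homog b (0 : A) ;
  homogD : forall b (x y : A), homog b x -> homog b y -> homog b (x + y) ;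
  homogZ : forall b (c : k) (x : A), homog b x -> homog b (sconst c * x) ;
  homog_decomp : forall x : A,
    exists x0 x1, [/\ homog false x0, homog true x1 & x = x0 + x1] ;
  homog_direct : forall x : A, homog false x -> homog true x -> x = 0 ;
  homogM : forall a b (x y : A),
    homog a x -> homog b y -> homog (a (+) b) (x * y) ;
}.

#[short(type="superalgType")]
HB.structure Definition Superalgebra (k : fieldType) :=
  {A of GRing.PzRing A & isSuperalgebra k A}.

Section Superalgebras.
Variable k : fieldType.
Local Open Scope classical_set_scope.

Definition supercommutative (A : superalgType k) : Prop :=
  forall a b (x y : A), homog a x -> homog b y ->
    x * y = (-1) ^+ (a && b) * (y * x).

Record superhom (A B : superalgType k) := Superhom {
  superhom_fun :> A -> B ;
  superhom_additive : zmod_morphism superhom_fun ;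
  superhom_monoid : monoid_morphism superhom_fun ;
  superhom_sconst : forall c, superhom_fun (sconst c) = sconst c ;
  superhom_homog : forall b x, homog b x -> homog b (superhom_fun x) ;
}.

Definition graded_ideal (A : superalgType k) (I : set A) : Prop :=
  [/\ I 0, forall x y, I x -> I y -> I (x + y),
      forall a x, I x -> I (a * x), forall a x, I x -> I (x * a)
    & forall x0 x1, homog false x0 -> homog true x1 ->
        I (x0 + x1) -> I x0 /\ I x1].

Definition proper_graded_ideal (A : superalgType k) (I : set A) : Prop :=
  graded_ideal I /\ I != setT.

Definition maximal_graded_ideal (A : superalgType k) (M : set A) : Prop :=
  proper_graded_ideal M /\
  forall I, proper_graded_ideal I -> M `<=` I -> I = M.

Definition local_superalgebra (A : superalgType k) : Prop :=
  exists! M : set A, maximal_graded_ideal M.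

(* On local superalgebras this says that h maps the maximal graded ideal of A
   into that of B. *)
Definition local_morphism (A B : superalgType k) (h : A -> B) : Prop :=
  forall (M : set A) (N : set B),
    maximal_graded_ideal M -> maximal_graded_ideal N -> h @` M `<=` N.

End Superalgebras.

Section SuperhomTheory.
Variables (k : fieldType) (A B : superalgType k) (h : superhom A B).

HB.instance Definition _ :=
  GRing.isZmodMorphism.Build A B h (@superhom_additive _ _ _ h).
HB.instance Definition _ :=
  GRing.isMonoidMorphism.Build A B h (@superhom_monoid _ _ _ h).

End SuperhomTheory.

(* An element of the Grassmann algebra is the family of its coefficients in the
   basis (e_S)_S, e_S being the product of the generators indexed by S in
   increasing order. *)
Definition grassmann (k : fieldType) (q : nat) : Type :=
  {ffun {set 'I_q} -> k}.

Section Grassmann.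
Variables (k : fieldType) (q : nat).
Implicit Types (S A B C : {set 'I_q}) (f g h : grassmann k q).

HB.instance Definition _ := GRing.Zmodule.copy (grassmann k q)
  {ffun {set 'I_q} -> k}.

(* e_A * e_B = grsign A B e_(A u B) *)
Definition inversions A B : nat :=
  #|[set p : 'I_q * 'I_q | [&& p.1 \in A, p.2 \in B & (p.2 < p.1)%N]]|.

Definition grsign A B : k :=
  if [disjoint A & B] then (-1) ^+ inversions A B else 0.

Definition grone : grassmann k q := [ffun S => (S == finset.set0)%:R].

Definition grmul f g : grassmann k q :=
  [ffun S => \sum_(p : {set 'I_q} * {set 'I_q} | p.1 :|: p.2 == S)
               grsign p.1 p.2 * f p.1 * g p.2].

Lemma inversionsUl A B C : [disjoint A & B] ->
  inversions (A :|: B) C = (inversions A C + inversions B C)%N.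
Proof.
move=> dAB; rewrite /inversions -cardsUI.
rewrite [X in (_ + X)%N](_ : _ = 0%N) ?addn0; last first.
  apply/eqP; rewrite cards_eq0 -finset.subset0; apply/fintype.subsetP => p.
  rewrite !inE => /andP[/and3P[pA _ _] /and3P[pB _ _]].
  by rewrite (disjointFr dAB pA) in pB.
apply: eq_card => p; rewrite !inE.
by case: (p.1 \in A); case: (p.1 \in B); case: (p.2 \in C); case: (_ < _)%N.
Qed.

Lemma inversionsUr A B C : [disjoint B & C] ->
  inversions A (B :|: C) = (inversions A B + inversions A C)%N.
Proof.
move=> dBC; rewrite /inversions -cardsUI.
rewrite [X in (_ + X)%N](_ : _ = 0%N) ?addn0; last first.
  apply/eqP; rewrite cards_eq0 -finset.subset0; apply/fintype.subsetP => p.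
  rewrite !inE => /andP[/and3P[_ pB _] /and3P[_ pC _]].
  by rewrite (disjointFr dBC pB) in pC.
apply: eq_card => p; rewrite !inE.
by case: (p.1 \in A); case: (p.2 \in B); case: (p.2 \in C); case: (_ < _)%N.
Qed.

Lemma inversionsC A B : [disjoint A & B] ->
  (inversions A B + inversions B A = #|A| * #|B|)%N.
Proof.
move=> dAB; rewrite -cardsX.
have -> : inversions B A = #|[set p : 'I_q * 'I_q |
    [&& p.1 \in A, p.2 \in B & (p.1 < p.2)%N]]|.
  pose sw (p : 'I_q * 'I_q) := (p.2, p.1).
  have swK : cancel sw sw by case.
  rewrite /inversions -(card_imset _ (can_inj swK)).
  apply: eq_card => -[a b]; apply/imsetP/idP => /= [[[c d]]|].
    by rewrite !inE /= => /and3P[cB dA ltdc] [-> ->]; rewrite cB dA.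
  rewrite !inE /= => /and3P[aA bB ltab]; exists (b, a) => //.
  by rewrite !inE /= aA bB.
rewrite -cardsUI [X in (_ + X)%N](_ : _ = 0%N) ?addn0; last first.
  apply/eqP; rewrite cards_eq0 -finset.subset0; apply/fintype.subsetP => p.
  rewrite !inE => /andP[/and3P[_ _ lt1] /and3P[_ _ lt2]].
  by have := ltn_trans lt1 lt2; rewrite ltnn.
apply: eq_card => -[a b]; rewrite !inE /=.
case aA : (a \in A) => //=; case bB : (b \in B) => //=.
rewrite -neq_ltn eq_sym; apply/eqP => /val_inj ab.
by move: (disjointFr dAB aA); rewrite ab bB.
Qed.

Lemma inversions0l A : inversions finset.set0 A = 0%N.
Proof.
by apply/eqP; rewrite cards_eq0 -finset.subset0; apply/fintype.subsetP => p;
  rewrite !inE.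
Qed.

Lemma inversions0r A : inversions A finset.set0 = 0%N.
Proof.
by apply/eqP; rewrite cards_eq0 -finset.subset0; apply/fintype.subsetP => p;
  rewrite !inE andbF.
Qed.

Lemma disjointUl A B C :
  [disjoint A :|: B & C] = [disjoint A & C] && [disjoint B & C].
Proof. by rewrite -!setI_eq0 finset.setIUl finset.setU_eq0. Qed.

Lemma disjointUr A B C :
  [disjoint A & B :|: C] = [disjoint A & B] && [disjoint A & C].
Proof. by rewrite -!setI_eq0 finset.setIUr finset.setU_eq0. Qed.

Lemma grsign_cocycle A B C :
  grsign A B * grsign (A :|: B) C = grsign B C * grsign A (B :|: C).
Proof.
rewrite /grsign disjointUl disjointUr.
have [dAB|] := boolP [disjoint A & B]; last by rewrite mul0r mulr0.
have [dBC|] := boolP [disjoint B & C]; last by rewrite andbF mul0r mulr0.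
have [dAC|] := boolP [disjoint A & C]; last by rewrite !mulr0.
rewrite inversionsUl// inversionsUr// -!exprD addnA; congr (_ ^+ _).
exact: addnC.
Qed.

Lemma grsign0l A : grsign finset.set0 A = 1.
Proof. by rewrite /grsign -setI_eq0 finset.set0I eqxx inversions0l. Qed.

Lemma grsign0r A : grsign A finset.set0 = 1.
Proof. by rewrite /grsign -setI_eq0 finset.setI0 eqxx inversions0r. Qed.

Lemma grsignC A B : grsign A B = (-1) ^+ (odd #|A| && odd #|B|) * grsign B A.
Proof.
rewrite /grsign [in RHS]disjoint_sym.
have [dAB|] := boolP [disjoint A & B]; last by rewrite mulr0.
have /(congr1 odd) := inversionsC dAB; rewrite oddD oddM => <-.
rewrite -[LHS]signr_odd -[(-1) ^+ inversions B A]signr_odd.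
by rewrite -signr_addb -addbA addbb addbF.
Qed.

Lemma grmulE f g S : grmul f g S =
  \sum_A \sum_B (A :|: B == S)%:R * (grsign A B * f A * g B).
Proof.
rewrite ffunE pair_big big_mkcond /=; apply: eq_bigr => -[A B] _ /=.
by case: eqP => _; rewrite ?mul1r ?mul0r.
Qed.

Lemma grmulA : associative grmul.
Proof.
move=> f g h; apply/ffunP => S.
transitivity (\sum_A \sum_B \sum_C (A :|: B :|: C == S)%:R *
   (grsign A B * grsign (A :|: B) C * f A * g B * h C)).
  rewrite grmulE; apply: eq_bigr => A _.
  transitivity (\sum_D \sum_B \sum_C (A :|: D == S)%:R * (B :|: C == D)%:R *
    (grsign B C * grsign A D * f A * g B * h C)).
    apply: eq_bigr => D _; rewrite grmulE !mulr_sumr; apply: eq_bigr => B _.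
    by rewrite !mulr_sumr; apply: eq_bigr => C _; ring.
  rewrite exchange_big; apply: eq_bigr => B _.
  rewrite exchange_big; apply: eq_bigr => C _ /=.
  rewrite (bigD1 (B :|: C)) //= eqxx mulr1 big1 ?addr0.
    by rewrite finset.setUA grsign_cocycle.
  by move=> D /negPf; rewrite eq_sym => ->; rewrite mulr0 mul0r.
rewrite grmulE; symmetry.
transitivity (\sum_D \sum_A \sum_B \sum_C (D :|: C == S)%:R *
  (A :|: B == D)%:R * (grsign A B * grsign D C * f A * g B * h C)).
  rewrite [RHS](_ : _ = \sum_D \sum_C \sum_A \sum_B (D :|: C == S)%:R *
    (A :|: B == D)%:R * (grsign A B * grsign D C * f A * g B * h C)); last first.
    apply: eq_bigr => D _; rewrite [RHS]exchange_big; apply: eq_bigr => A _.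
    by rewrite exchange_big.
  apply: eq_bigr => D _; apply: eq_bigr => C _; rewrite grmulE.
  rewrite mulr_sumr mulr_suml mulr_sumr; apply: eq_bigr => A _.
  rewrite mulr_sumr mulr_suml mulr_sumr; apply: eq_bigr => B _.
  by ring.
rewrite exchange_big; apply: eq_bigr => A _.
rewrite exchange_big; apply: eq_bigr => B _.
rewrite exchange_big; apply: eq_bigr => C _ /=.
rewrite (bigD1 (A :|: B)) //= eqxx mulr1 big1 ?addr0 //.
by move=> D /negPf; rewrite eq_sym => ->; rewrite mulr0 mul0r.
Qed.

Lemma grmul1r : left_id grone grmul.
Proof.
move=> f; apply/ffunP => S; rewrite grmulE (bigD1 finset.set0) //=.
rewrite [X in _ + X]big1 ?addr0; last first.
  move=> A /negPf A0; rewrite big1 // => B _.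
  by rewrite ffunE A0 mulr0 mul0r mulr0.
rewrite (bigD1 S) //= big1 ?addr0.
  by rewrite finset.set0U eqxx grsign0l ffunE eqxx !mul1r.
by move=> B /negPf BS; rewrite finset.set0U BS mul0r.
Qed.

Lemma grmulr1 : right_id grone grmul.
Proof.
move=> f; apply/ffunP => S; rewrite grmulE (bigD1 S) //=.
rewrite [X in _ + X]big1 ?addr0; last first.
  move=> A /negPf AS; rewrite big1 // => B _.
  rewrite ffunE; case: (B =P finset.set0) => [->|_]; last by rewrite !mulr0.
  by rewrite finset.setU0 AS mul0r.
rewrite (bigD1 finset.set0) //= big1 ?addr0.
  by rewrite finset.setU0 eqxx grsign0r ffunE eqxx mulr1 !mul1r.
by move=> B /negPf B0; rewrite [grone _]ffunE B0 !mulr0.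
Qed.

Lemma grmulDl : left_distributive grmul +%R.
Proof.
move=> f g h; apply/ffunP => S; rewrite [RHS]ffunE !grmulE -big_split /=.
apply: eq_bigr => A _; rewrite -big_split /=; apply: eq_bigr => B _.
by rewrite ffunE; ring.
Qed.

Lemma grmulDr : right_distributive grmul +%R.
Proof.
move=> f g h; apply/ffunP => S; rewrite [RHS]ffunE !grmulE -big_split /=.
apply: eq_bigr => A _; rewrite -big_split /=; apply: eq_bigr => B _.
by rewrite ffunE; ring.
Qed.

HB.instance Definition _ := GRing.Zmodule_isPzRing.Build (grassmann k q)
  grmulA grmul1r grmulr1 grmulDl grmulDr.

Definition grconst (c : k) : grassmann k q :=
  [ffun S => if S == finset.set0 then c else 0].

Lemma grconstMl (c : k) (f : grassmann k q) S : (grconst c * f) S = c * f S.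
Proof.
rewrite [LHS]grmulE (bigD1 finset.set0) //=.
rewrite [X in _ + X]big1 ?addr0; last first.
  move=> A /negPf A0; rewrite big1 // => B _.
  by rewrite ffunE A0 mulr0 mul0r mulr0.
rewrite (bigD1 S) //= big1 ?addr0.
  by rewrite finset.set0U eqxx grsign0l ffunE eqxx !mul1r.
by move=> B /negPf BS; rewrite finset.set0U BS mul0r.
Qed.

Lemma grconst_central (c : k) (f : grassmann k q) :
  grconst c * f = f * grconst c.
Proof.
apply/ffunP => S; rewrite grconstMl; symmetry.
rewrite [LHS]grmulE (bigD1 S) //=.
rewrite [X in _ + X]big1 ?addr0; last first.
  move=> A /negPf AS; rewrite big1 // => B _.
  rewrite ffunE; case: (B =P finset.set0) => [->|_]; last by rewrite !mulr0.
  by rewrite finset.setU0 AS mul0r.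
rewrite (bigD1 finset.set0) //= big1 ?addr0.
  by rewrite finset.setU0 eqxx grsign0r ffunE eqxx !mul1r mulrC.
by move=> B /negPf B0; rewrite [grconst _ _]ffunE B0 !mulr0.
Qed.

Lemma grconst_additive : zmod_morphism grconst.
Proof.
by move=> c d; apply/ffunP => S; rewrite !ffunE; case: ifP; rewrite ?subr0.
Qed.

Lemma grconst_monoid : monoid_morphism grconst.
Proof.
split; first by apply/ffunP => S; rewrite !ffunE; case: ifP.
move=> c d; apply/ffunP => S; rewrite grconstMl !ffunE.
by case: ifP => _; rewrite ?mulr0.
Qed.

HB.instance Definition _ :=
  GRing.isZmodMorphism.Build k (grassmann k q) grconst grconst_additive.
HB.instance Definition _ :=
  GRing.isMonoidMorphism.Build k (grassmann k q) grconst grconst_monoid.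

Definition grhomog (b : bool) : set (grassmann k q) :=
  fun f => forall S, odd #|S| != b -> f S = 0.

Lemma grhomog0 b : grhomog b 0.
Proof. by move=> S _; rewrite ffunE. Qed.

Lemma grhomogD b f g : grhomog b f -> grhomog b g -> grhomog b (f + g).
Proof. by move=> hf hg S oS; rewrite ffunE hf// hg// addr0. Qed.

Lemma grhomogZ b c f : grhomog b f -> grhomog b (grconst c * f).
Proof. by move=> hf S oS; rewrite grconstMl hf// mulr0. Qed.

Lemma grhomog_decomp f :
  exists f0 f1, [/\ grhomog false f0, grhomog true f1 & f = f0 + f1].
Proof.
exists [ffun S : {set 'I_q} => if odd #|S| then 0 else f S].
exists [ffun S : {set 'I_q} => if odd #|S| then f S else 0].
split=> [S|S|]; rewrite ?ffunE; try by case: (odd _).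
by apply/ffunP => S; rewrite !ffunE; case: ifP; rewrite ?add0r ?addr0.
Qed.

Lemma grhomog_direct f : grhomog false f -> grhomog true f -> f = 0.
Proof.
move=> f0 f1; apply/ffunP => S; rewrite ffunE.
by case oS: (odd #|S|); [apply: f0|apply: f1]; rewrite oS.
Qed.

Lemma grhomogM a b f g :
  grhomog a f -> grhomog b g -> grhomog (a (+) b) (f * g).
Proof.
move=> hf hg S oS; rewrite [LHS]grmulE big1 // => A _; rewrite big1 // => B _.
case: eqP => [ABS|_]; last by rewrite mul0r.
have [dAB|] := boolP [disjoint A & B]; last first.
  by rewrite /grsign => /negPf ->; rewrite !mul0r mulr0.
have [oA|oA] := eqVneq (odd #|A|) a; last by rewrite (hf A oA) mulr0 mul0r mulr0.
have [oB|oB] := eqVneq (odd #|B|) b; last by rewrite (hg B oB) !mulr0.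
by move: oS; rewrite -ABS cardsU disjoint_setI0 // cards0 subn0 oddD oA oB eqxx.
Qed.

HB.instance Definition _ := @isSuperalgebra.Build k (grassmann k q) grconst
  grconst_central grhomog grhomog0 grhomogD grhomogZ grhomog_decomp
  grhomog_direct grhomogM.

End Grassmann.

Section GrassmannLocal.
Variables (k : fieldType) (q : nat).
Implicit Types (S A B : {set 'I_q}) (f g x : grassmann k q).

Lemma grassmann_supercommutative : supercommutative (grassmann k q).
Proof.
move=> a b f g hf hg; apply/ffunP => S.
have -> : (-1) ^+ (a && b) = grconst q ((-1) ^+ (a && b)) :> grassmann k q.
  by rewrite rmorphXn rmorphN rmorph1.
rewrite grconstMl [LHS]grmulE exchange_big [X in _ * X]grmulE mulr_sumr.
apply: eq_bigr => B _; rewrite mulr_sumr; apply: eq_bigr => A _.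
rewrite finset.setUC grsignC.
have [oA|oA] := eqVneq (odd #|A|) a; last by rewrite (hf A oA); ring.
have [oB|oB] := eqVneq (odd #|B|) b; last by rewrite (hg B oB); ring.
by rewrite oA oB; ring.
Qed.

Definition grbody f : k := f finset.set0.

Lemma grbody1 : grbody 1 = 1.
Proof. by rewrite /grbody [LHS]ffunE eqxx. Qed.

Lemma grbodyB f g : grbody (f - g) = grbody f - grbody g.
Proof. by rewrite /grbody !ffunE. Qed.

Lemma grbodyM f g : grbody (f * g) = grbody f * grbody g.
Proof.
rewrite /grbody [LHS]grmulE (bigD1 finset.set0) //=.
rewrite [X in _ + X]big1 ?addr0; last first.
  move=> A A0; rewrite big1 // => B _.
  by rewrite finset.setU_eq0 (negPf A0) mul0r.
rewrite (bigD1 finset.set0) //= big1 ?addr0.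
  by rewrite finset.set0U eqxx grsign0l !mul1r.
by move=> B /negPf B0; rewrite finset.set0U B0 mul0r.
Qed.

Lemma grassmann_nilp x n S : grbody x = 0 -> (#|S| < n)%N -> (x ^+ n) S = 0.
Proof.
move=> x0; elim: n S => [//|n IHn] S; rewrite ltnS exprS => leSn.
rewrite [LHS]grmulE big1 // => A _; rewrite big1 // => B _.
case: eqP => [ABS|_]; last by rewrite mul0r.
have [dAB|] := boolP [disjoint A & B]; last first.
  by rewrite /grsign => /negPf ->; rewrite !mul0r mulr0.
have [A0|A0] := eqVneq A finset.set0.
  by rewrite A0 [x _]x0 mulr0 mul0r mulr0.
rewrite IHn ?mulr0//; move: leSn.
rewrite -ABS cardsU disjoint_setI0 // cards0 subn0; apply: leq_trans.
by rewrite -[X in (X < _)%N]add0n ltn_add2r card_gt0.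
Qed.

Lemma grassmann_linv f : grbody f != 0 -> exists g, g * f = 1.
Proof.
move=> f0; pose u := grconst q (grbody f)^-1 * f; pose x := 1 - u.
have x0 : grbody x = 0.
  by rewrite grbodyB grbody1 /u /grbody grconstMl mulVf// subrr.
have xq : x ^+ q.+1 = 0.
  apply/ffunP => S; rewrite ffunE grassmann_nilp//.
  by rewrite ltnS -[X in (_ <= X)%N](card_ord q) max_card.
exists ((\sum_(i < q.+1) x ^+ i) * grconst q (grbody f)^-1).
rewrite -mulrA -/u; have -> : u = 1 - x by rewrite /x opprB addrC subrK.
rewrite mulrBr mulr1.
have -> : (\sum_(i < q.+1) x ^+ i) * x = x * (\sum_(i < q.+1) x ^+ i).
  by rewrite mulr_suml mulr_sumr; apply: eq_bigr => i _; rewrite -exprS -exprSr.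
have := subrX1 x q.+1; rewrite xq mulrBl mul1r sub0r => e.
by apply: oppr_inj; rewrite opprB.
Qed.

Local Open Scope classical_set_scope.

Lemma grassmann_local : local_superalgebra (grassmann k q).
Proof.
pose M : set (grassmann k q) := [set f | grbody f = 0].
have Mideal : graded_ideal M.
  split; rewrite /M /=.
  - by rewrite /grbody ffunE.
  - by move=> f g f0 g0; rewrite /grbody ffunE [f _]f0 [g _]g0 addr0.
  - by move=> a f f0; rewrite grbodyM f0 mulr0.
  - by move=> a f f0; rewrite grbodyM f0 mul0r.
  - move=> f0 f1 hf0 hf1; have f10 : grbody f1 = 0 by apply: hf1; rewrite cards0.
    by rewrite /grbody ffunE [f1 _]f10 addr0.
have Mproper : proper_graded_ideal M.
  split=> //; apply/eqP => /seteqP[_ /(_ 1 I) M1].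
  by have /eqP : grbody 1 = 0 := M1; rewrite grbody1 oner_eq0.
have subM I : proper_graded_ideal I -> I `<=` M.
  move=> [[_ _ Il _ _] /eqP IT] f If; apply: contrapT => /eqP f0; apply: IT.
  have [g gf] := grassmann_linv f0.
  by apply/seteqP; split=> // h _; rewrite -[h]mulr1 -gf mulrA; apply: Il.
exists M; split=> [|N [Np Nmax]].
  by split=> // I Ip MI; apply/seteqP; split=> //; exact: subM.
by apply: Nmax => //; exact: subM.
Qed.

End GrassmannLocal.

Section Transfer.
Variable k : fieldType.
Local Open Scope classical_set_scope.

Lemma preimage_graded_ideal (A B : superalgType k) (h : superhom A B)
  (I : set B) : graded_ideal I -> graded_ideal (h @^-1` I).
Proof.
move=> [I0 ID Il Ir Ig]; split; rewrite /preimage /=.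
- by rewrite raddf0.
- by move=> x y Ix Iy; rewrite raddfD; apply: ID.
- by move=> a x Ix; rewrite rmorphM; apply: Il.
- by move=> a x Ix; rewrite rmorphM; apply: Ir.
- move=> x0 x1 h0 h1; rewrite raddfD; apply: Ig; exact: superhom_homog.
Qed.

Lemma preimage_proper_graded_ideal (A B : superalgType k) (h : superhom A B)
  (I : set B) : (forall y, exists x, h x = y) ->
  proper_graded_ideal I -> proper_graded_ideal (h @^-1` I).
Proof.
move=> hs [Ii /eqP IT]; split; first exact: preimage_graded_ideal.
apply/eqP => /seteqP[_ hT]; apply: IT; apply/seteqP; split=> // y _.
by have [x <-] := hs y; apply: hT.
Qed.

Lemma local_superalgebra_iso (A B : superalgType k) (h : superhom A B)
    (g : superhom B A) : cancel h g -> cancel g h ->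
  local_superalgebra A -> local_superalgebra B.
Proof.
move=> hK gK [M [[Mp Mmax] Muniq]].
have hs y : exists x, h x = y by exists (g y).
have gs y : exists x, g x = y by exists (h y).
have hg (I : set A) : h @^-1` (g @^-1` I) = I.
  by apply/seteqP; split=> x; rewrite /preimage /= hK.
have gh (I : set B) : g @^-1` (h @^-1` I) = I.
  by apply/seteqP; split=> x; rewrite /preimage /= gK.
exists (g @^-1` M); split=> [|N [Np Nmax]].
  split=> [|I Ip MI]; first exact: preimage_proper_graded_ideal.
  rewrite -(gh I); congr (g @^-1` _); apply: Mmax.
    exact: preimage_proper_graded_ideal.
  by rewrite -(hg M) => x /MI.
rewrite -(gh N); congr (g @^-1` _); apply: Muniq; split.
  exact: preimage_proper_graded_ideal.
move=> I Ip NI; rewrite -(hg I); congr (h @^-1` _); apply: Nmax.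
  exact: preimage_proper_graded_ideal.
by rewrite -(gh N) => x /NI.
Qed.

End Transfer.

Section FunctionSuperalgebra.
Variables (k : fieldType) (T : Type) (A : superalgType k).
Implicit Types f g : T -> A.

Definition fun_sconst (c : k) : T -> A := fun=> sconst c.

Lemma fun_sconst_additive : zmod_morphism fun_sconst.
Proof. by move=> c d; apply/funext => t; rewrite /fun_sconst raddfB. Qed.

Lemma fun_sconst_monoid : monoid_morphism fun_sconst.
Proof.
split; first by apply/funext => t; rewrite /fun_sconst rmorph1.
by move=> c d; apply/funext => t; rewrite /fun_sconst rmorphM.
Qed.

HB.instance Definition _ :=
  GRing.isZmodMorphism.Build k (T -> A) fun_sconst fun_sconst_additive.
HB.instance Definition _ :=
  GRing.isMonoidMorphism.Build k (T -> A) fun_sconst fun_sconst_monoid.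

Lemma fun_sconst_central c f : fun_sconst c * f = f * fun_sconst c.
Proof. by apply/funext => t; exact: sconst_central. Qed.

Definition fun_homog (b : bool) : set (T -> A) :=
  fun f => forall t, homog b (f t).

Lemma fun_homog0 b : fun_homog b 0.
Proof. by move=> t; exact: homog0. Qed.

Lemma fun_homogD b f g : fun_homog b f -> fun_homog b g -> fun_homog b (f + g).
Proof. by move=> hf hg t; exact: homogD. Qed.

Lemma fun_homogZ b c f : fun_homog b f -> fun_homog b (fun_sconst c * f).
Proof. by move=> hf t; exact: homogZ. Qed.

Lemma fun_homog_decomp f :
  exists f0 f1, [/\ fun_homog false f0, fun_homog true f1 & f = f0 + f1].
Proof.
have /choice[f0 /choice[f1 f01]] := fun t => homog_decomp (f t).
exists f0, f1; split=> [t|t|]; try by have [] := f01 t.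
by apply/funext => t; have [] := f01 t.
Qed.

Lemma fun_homog_direct f : fun_homog false f -> fun_homog true f -> f = 0.
Proof. by move=> f0 f1; apply/funext => t; exact: homog_direct. Qed.

Lemma fun_homogM a b f g :
  fun_homog a f -> fun_homog b g -> fun_homog (a (+) b) (f * g).
Proof. by move=> hf hg t; exact: homogM. Qed.

HB.instance Definition _ := @isSuperalgebra.Build k (T -> A) fun_sconst
  fun_sconst_central fun_homog fun_homog0 fun_homogD fun_homogZ
  fun_homog_decomp fun_homog_direct fun_homogM.

End FunctionSuperalgebra.

Local Open Scope classical_set_scope.
Local Open Scope quotient_scope.

Record opens (X : topologicalType) := Opens {
  oset :> set X ;
  osetP : open oset ;
}.

Definition opensT (X : topologicalType) : opens X := Opens (@openT X).

Definition opensI (X : topologicalType) (U V : opens X) : opens X :=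
  Opens (openI (osetP U) (osetP V)).

Lemma opensIl (X : topologicalType) (U V : opens X) : opensI U V `<=` U.
Proof. by move=> x []. Qed.

Lemma opensIr (X : topologicalType) (U V : opens X) : opensI U V `<=` V.
Proof. by move=> x []. Qed.

Definition opens_preimage (X Y : topologicalType) (f : X -> Y)
    (cf : continuous f) (V : opens Y) : opens X :=
  Opens (open_comp (fun x _ => cf x) (osetP V)).

Record presheaf (k : fieldType) (X : topologicalType) := Presheaf {
  sect :> opens X -> superalgType k ;
  res : forall U V : opens X, V `<=` U -> superhom (sect U) (sect V) ;
  res_id : forall (U : opens X) (UU : U `<=` U) (s : sect U), res UU s = s ;
  res_comp : forall (U V W : opens X) (VU : V `<=` U) (WV : W `<=` V)
    (WU : W `<=` U) (s : sect U), res WV (res VU s) = res WU s ;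
}.
Arguments res {k X} p {U V} _.

Definition is_sheaf (k : fieldType) (X : topologicalType) (F : presheaf k X) :
    Prop :=
  forall (I : Type) (U : opens X) (V : I -> opens X)
    (VU : forall i, V i `<=` U), U `<=` \bigcup_i V i ->
  forall s : forall i, F (V i),
    (forall i j, res F (@opensIl _ (V i) (V j)) (s i) =
                 res F (@opensIr _ (V i) (V j)) (s j)) ->
  exists! t : F U, forall i, res F (VU i) t = s i.

Section Stalk.
Variables (k : fieldType) (X : topologicalType) (F : presheaf k X) (x : X).

Record germ_rep := GermRep {
  germ_dom : opens X ;
  germ_mem : oset germ_dom x ;
  germ_sec : F germ_dom ;
}.

HB.instance Definition _ := gen_eqMixin germ_rep.
HB.instance Definition _ := gen_choiceMixin germ_rep.

Definition germ_equiv (s t : germ_rep) : bool :=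
  `[< exists (W : opens X) (Ws : W `<=` germ_dom s) (Wt : W `<=` germ_dom t),
        oset W x /\ res F Ws (germ_sec s) = res F Wt (germ_sec t) >].

Lemma germ_equiv_refl : reflexive germ_equiv.
Proof.
move=> s; apply/asboolP; exists (germ_dom s).
exists (@subset_refl _ _), (@subset_refl _ _).
by split=> //; exact: germ_mem.
Qed.

Lemma germ_equiv_sym : symmetric germ_equiv.
Proof.
by move=> s t; apply/asboolP/asboolP => -[W [Ws [Wt [Wx e]]]];
  exists W, Wt, Ws; split.
Qed.

Lemma germ_equiv_trans : transitive germ_equiv.
Proof.
move=> t s u /asboolP[W [Ws [Wt [Wx e]]]] /asboolP[W' [Wt' [Wu' [Wx' e']]]].
pose l := @opensIl _ W W'.
pose r := @opensIr _ W W'.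
apply/asboolP; exists (opensI W W'), (subset_trans l Ws), (subset_trans r Wu').
split=> //.
rewrite -(res_comp Ws l) e -(res_comp Wu' r) -e'.
by rewrite (res_comp _ _ (subset_trans l Wt)) (res_comp _ _ (subset_trans l Wt)).
Qed.

Canonical germ_equiv_equiv :=
  EquivRel germ_equiv germ_equiv_refl germ_equiv_sym germ_equiv_trans.

Definition stalk : Type := {eq_quot germ_equiv}.
HB.instance Definition _ := Choice.on stalk.
HB.instance Definition _ := EqQuotient.on stalk.

Definition germ (U : opens X) (Ux : oset U x) (s : F U) : stalk :=
  \pi_stalk (GermRep Ux s).

Lemma germ_eqP (U V : opens X) (Ux : oset U x) (Vx : oset V x) s t :
  germ Ux s = germ Vx t <->
  exists (W : opens X) (WU : W `<=` U) (WV : W `<=` V),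
    oset W x /\ res F WU s = res F WV t.
Proof.
split; first by move=> /eqmodP /asboolP.
by move=> e; apply/eqmodP/asboolP.
Qed.

Lemma germ_res (U V : opens X) (VU : V `<=` U) (Ux : oset U x) (Vx : oset V x)
  s : germ Vx (res F VU s) = germ Ux s.
Proof.
apply/germ_eqP; exists V, (@subset_refl _ _), VU; split=> //.
by rewrite res_id.
Qed.

Lemma stalkP (a : stalk) : exists U (Ux : oset U x) s, a = germ Ux s.
Proof.
elim/quotW: a => -[U Ux s]; by exists U, Ux, s.
Qed.

Lemma stalkP2 (a b : stalk) :
  exists U (Ux : oset U x) s t, a = germ Ux s /\ b = germ Ux t.
Proof.
have [U [Ux [s ->]]] := stalkP a; have [V [Vx [t ->]]] := stalkP b.
have UVx : oset (opensI U V) x by [].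
exists (opensI U V), UVx, (res F (@opensIl _ U V) s).
by exists (res F (@opensIr _ U V) t); rewrite !germ_res.
Qed.

Lemma stalkP3 (a b c : stalk) : exists U (Ux : oset U x) s t u,
  [/\ a = germ Ux s, b = germ Ux t & c = germ Ux u].
Proof.
have [U [Ux [s [t [-> ->]]]]] := stalkP2 a b; have [V [Vx [u ->]]] := stalkP c.
have UVx : oset (opensI U V) x by [].
pose l := @opensIl _ U V.
exists (opensI U V), UVx, (res F l s), (res F l t).
by exists (res F (@opensIr _ U V) u); rewrite !germ_res.
Qed.

Definition stalk_lift2 (op : forall U, F U -> F U -> F U) (a b : stalk) :
    stalk :=
  let s := repr a in let t := repr b in
  germ (conj (germ_mem s) (germ_mem t) : oset (opensI _ _) x)
    (op _ (res F (@opensIl _ (germ_dom s) (germ_dom t)) (germ_sec s))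
          (res F (@opensIr _ (germ_dom s) (germ_dom t)) (germ_sec t))).

Lemma stalk_lift2E (op : forall U, F U -> F U -> F U) :
  (forall (U V : opens X) (VU : V `<=` U) s t,
      res F VU (op U s t) = op V (res F VU s) (res F VU t)) ->
  forall U (Ux : oset U x) s t,
    stalk_lift2 op (germ Ux s) (germ Ux t) = germ Ux (op U s t).
Proof.
move=> opres U Ux s t; rewrite /stalk_lift2.
set a := repr (germ Ux s); set b := repr (germ Ux t).
have : \pi_stalk a = germ Ux s by rewrite /a reprK.
case: a => A Ax sa; move=> /germ_eqP[Wa [WaA [WaU [Wax ea]]]].
have : \pi_stalk b = germ Ux t by rewrite /b reprK.
case: b => B Bx sb; move=> /germ_eqP[Wb [WbB [WbU [Wbx eb]]]] /=.
apply/germ_eqP; pose W := opensI Wa Wb.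
have WAB : W `<=` opensI A B by move=> y [/WaA ? /WbB ?].
have WU : W `<=` U by move=> y [/WaU].
have WWa : W `<=` Wa by move=> y [].
have WWb : W `<=` Wb by move=> y [].
exists W, WAB, WU; split=> //; rewrite !opres; congr op.
  rewrite (res_comp _ _ (subset_trans WWa WaA)) -(res_comp _ WWa) ea.
  by rewrite (res_comp _ _ WU).
rewrite (res_comp _ _ (subset_trans WWb WbB)) -(res_comp _ WWb) eb.
by rewrite (res_comp _ _ WU).
Qed.

Lemma opensT_mem : oset (opensT X) x.
Proof. by []. Qed.

Definition stalk_const (c : forall U, F U) : stalk := germ opensT_mem (c _).

Lemma stalk_constE (c : forall U, F U) :
  (forall (U V : opens X) (VU : V `<=` U), res F VU (c U) = c V) ->
  forall U (Ux : oset U x), stalk_const c = germ Ux (c U).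
Proof.
move=> cres U Ux; pose UT : U `<=` opensT X := @subsetT _ U.
by rewrite /stalk_const -(germ_res UT opensT_mem Ux) cres.
Qed.

Definition stalk_zero := stalk_const (fun=> 0).
Definition stalk_one := stalk_const (fun=> 1).
Definition stalk_add := stalk_lift2 (fun U => +%R).
Definition stalk_mul := stalk_lift2 (fun U => *%R).

Definition stalk_sconst (c : k) := stalk_const (fun=> sconst c).
Definition stalk_opp (a : stalk) := stalk_lift2 (fun U s t => - s) a a.

Lemma stalk_zeroE U (Ux : oset U x) : stalk_zero = germ Ux 0.
Proof. by apply: (stalk_constE (c := fun=> 0)) => ? ? ?; rewrite raddf0. Qed.

Lemma stalk_oneE U (Ux : oset U x) : stalk_one = germ Ux 1.
Proof. by apply: (stalk_constE (c := fun=> 1)) => ? ? ?; rewrite rmorph1. Qed.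

Lemma stalk_sconstE c U (Ux : oset U x) : stalk_sconst c = germ Ux (sconst c).
Proof.
by apply: (stalk_constE (c := fun=> sconst c)) => ? ? ?; rewrite superhom_sconst.
Qed.

Lemma stalk_addE U (Ux : oset U x) s t :
  stalk_add (germ Ux s) (germ Ux t) = germ Ux (s + t).
Proof. by apply: stalk_lift2E => *; rewrite raddfD. Qed.

Lemma stalk_mulE U (Ux : oset U x) s t :
  stalk_mul (germ Ux s) (germ Ux t) = germ Ux (s * t).
Proof. by apply: stalk_lift2E => *; rewrite rmorphM. Qed.

Lemma stalk_oppE U (Ux : oset U x) s : stalk_opp (germ Ux s) = germ Ux (- s).
Proof. by apply: (stalk_lift2E (op := fun U s t => - s)) => *; rewrite raddfN. Qed.

Lemma stalk_addA : associative stalk_add.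
Proof.
move=> a b c; have [U [Ux [s [t [u [-> -> ->]]]]]] := stalkP3 a b c.
by rewrite !stalk_addE addrA.
Qed.

Lemma stalk_addC : commutative stalk_add.
Proof.
by move=> a b; have [U [Ux [s [t [-> ->]]]]] := stalkP2 a b; rewrite !stalk_addE addrC.
Qed.

Lemma stalk_add0 : left_id stalk_zero stalk_add.
Proof.
by move=> a; have [U [Ux [s ->]]] := stalkP a; rewrite (stalk_zeroE Ux) stalk_addE add0r.
Qed.

Lemma stalk_addN : left_inverse stalk_zero stalk_opp stalk_add.
Proof.
move=> a; have [U [Ux [s ->]]] := stalkP a.
by rewrite stalk_oppE stalk_addE addNr (stalk_zeroE Ux).
Qed.

HB.instance Definition _ := GRing.isZmodule.Build stalk
  stalk_addA stalk_addC stalk_add0 stalk_addN.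

Lemma stalk_mulA : associative stalk_mul.
Proof.
move=> a b c; have [U [Ux [s [t [u [-> -> ->]]]]]] := stalkP3 a b c.
by rewrite !stalk_mulE mulrA.
Qed.

Lemma stalk_mul1 : left_id stalk_one stalk_mul.
Proof.
by move=> a; have [U [Ux [s ->]]] := stalkP a; rewrite (stalk_oneE Ux) stalk_mulE mul1r.
Qed.

Lemma stalk_mulr1 : right_id stalk_one stalk_mul.
Proof.
by move=> a; have [U [Ux [s ->]]] := stalkP a; rewrite (stalk_oneE Ux) stalk_mulE mulr1.
Qed.

Lemma stalk_mulDl : left_distributive stalk_mul stalk_add.
Proof.
move=> a b c; have [U [Ux [s [t [u [-> -> ->]]]]]] := stalkP3 a b c.
by rewrite !stalk_addE !stalk_mulE stalk_addE mulrDl.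
Qed.

Lemma stalk_mulDr : right_distributive stalk_mul stalk_add.
Proof.
move=> a b c; have [U [Ux [s [t [u [-> -> ->]]]]]] := stalkP3 a b c.
by rewrite !stalk_addE !stalk_mulE stalk_addE mulrDr.
Qed.

HB.instance Definition _ :=
  GRing.Zmodule_isPzRing.Build stalk
    stalk_mulA stalk_mul1 stalk_mulr1 stalk_mulDl stalk_mulDr.

Lemma germD U (Ux : oset U x) s t : germ Ux (s + t) = germ Ux s + germ Ux t.
Proof. by rewrite [RHS]stalk_addE. Qed.

Lemma germN U (Ux : oset U x) s : germ Ux (- s) = - germ Ux s.
Proof. by rewrite [RHS]stalk_oppE. Qed.

Lemma germM U (Ux : oset U x) s t : germ Ux (s * t) = germ Ux s * germ Ux t.
Proof. by rewrite [RHS]stalk_mulE. Qed.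

Lemma germ0 U (Ux : oset U x) : germ Ux 0 = 0.
Proof. by rewrite -[LHS]stalk_zeroE. Qed.

Lemma germ1 U (Ux : oset U x) : germ Ux 1 = 1.
Proof. by rewrite -[LHS]stalk_oneE. Qed.

Lemma stalk_sconst_additive : zmod_morphism stalk_sconst.
Proof.
by move=> c d; rewrite /stalk_sconst /stalk_const raddfB germD germN.
Qed.

Lemma stalk_sconst_monoid : monoid_morphism stalk_sconst.
Proof.
split; first by rewrite /stalk_sconst /stalk_const rmorph1 germ1.
by move=> c d; rewrite /stalk_sconst /stalk_const rmorphM germM.
Qed.

HB.instance Definition _ :=
  GRing.isZmodMorphism.Build k stalk stalk_sconst stalk_sconst_additive.
HB.instance Definition _ :=
  GRing.isMonoidMorphism.Build k stalk stalk_sconst stalk_sconst_monoid.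

Lemma stalk_sconstC (c : k) (a : stalk) :
  stalk_sconst c * a = a * stalk_sconst c.
Proof.
have [U [Ux [s ->]]] := stalkP a.
by rewrite (stalk_sconstE c Ux) -!germM sconst_central.
Qed.

Definition stalk_homog (b : bool) : set stalk :=
  [set a | exists U (Ux : oset U x) s, homog b s /\ a = germ Ux s].

Lemma stalk_homog2 b (a a' : stalk) b' : stalk_homog b a -> stalk_homog b' a' ->
  exists U (Ux : oset U x) s t,
    [/\ homog b s, homog b' t, a = germ Ux s & a' = germ Ux t].
Proof.
move=> [U [Ux [s [hs ->]]]] [V [Vx [t [ht ->]]]].
have UVx : oset (opensI U V) x by [].
exists (opensI U V), UVx, (res F (@opensIl _ U V) s).
exists (res F (@opensIr _ U V) t); rewrite !germ_res.
by split=> //; apply: superhom_homog.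
Qed.

Lemma stalk_homog0 b : stalk_homog b 0.
Proof.
exists (opensT X), opensT_mem, 0.
by split; [exact: homog0|rewrite germ0].
Qed.

Lemma stalk_homogD b a a' :
  stalk_homog b a -> stalk_homog b a' -> stalk_homog b (a + a').
Proof.
move=> h h'; have [U [Ux [s [t [hs ht -> ->]]]]] := stalk_homog2 h h'.
by exists U, Ux, (s + t); rewrite germD; split=> //; exact: homogD.
Qed.

Lemma stalk_homogZ b c a :
  stalk_homog b a -> stalk_homog b (stalk_sconst c * a).
Proof.
move=> [U [Ux [s [hs ->]]]]; exists U, Ux, (sconst c * s).
by rewrite (stalk_sconstE c Ux) -germM; split=> //; exact: homogZ.
Qed.

Lemma stalk_homog_decomp a :
  exists a0 a1, [/\ stalk_homog false a0, stalk_homog true a1 & a = a0 + a1].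
Proof.
have [U [Ux [s ->]]] := stalkP a; have [s0 [s1 [h0 h1 ->]]] := homog_decomp s.
exists (germ Ux s0), (germ Ux s1); split; last by rewrite germD.
  by exists U, Ux, s0.
by exists U, Ux, s1.
Qed.

Lemma stalk_homog_direct a : stalk_homog false a -> stalk_homog true a -> a = 0.
Proof.
move=> [U [Ux [s [hs ->]]]] [V [Vx [t [ht /germ_eqP[W [WU [WV [Wx e]]]]]]]].
rewrite -(germ_res WU Ux Wx) -(germ0 Wx); congr germ; apply: homog_direct.
  exact: superhom_homog.
by rewrite e; exact: superhom_homog.
Qed.

Lemma stalk_homogM b b' a a' :
  stalk_homog b a -> stalk_homog b' a' -> stalk_homog (b (+) b') (a * a').
Proof.
move=> h h'; have [U [Ux [s [t [hs ht -> ->]]]]] := stalk_homog2 h h'.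
by exists U, Ux, (s * t); rewrite germM; split=> //; exact: homogM.
Qed.

HB.instance Definition _ := @isSuperalgebra.Build k stalk stalk_sconst
  stalk_sconstC stalk_homog stalk_homog0 stalk_homogD stalk_homogZ
  stalk_homog_decomp stalk_homog_direct stalk_homogM.

Lemma germ_sconst c U (Ux : oset U x) : germ Ux (sconst c) = sconst c.
Proof. by rewrite -[LHS]stalk_sconstE. Qed.

End Stalk.

Definition local_supercommutative (k : fieldType) (A : superalgType k) : Prop :=
  supercommutative A /\ local_superalgebra A.

(* The sheaf condition for the empty cover gives the zero algebra on the empty
   set, whence the restriction to nonempty open sets. *)
Record superspace (k : fieldType) := Superspace {
  carrier :> topologicalType ;
  struct_sheaf : presheaf k carrier ;
  struct_sheafP : is_sheaf struct_sheaf ;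
  section_local : forall U : opens carrier, U !=set0 ->
    local_supercommutative (struct_sheaf U) ;
  stalk_local : forall x : carrier,
    local_supercommutative (stalk struct_sheaf x) ;
}.
Arguments struct_sheaf {k}.

Section StalkMap.
Variables (k : fieldType) (X Y : superspace k) (f : X -> Y).
Variables (cf : continuous f)
  (fs : forall V : opens Y,
     superhom (struct_sheaf Y V) (struct_sheaf X (opens_preimage cf V))).

Definition stalk_map (x : X) (a : stalk (struct_sheaf Y) (f x)) :
    stalk (struct_sheaf X) x :=
  germ (germ_mem (repr a) : oset (opens_preimage cf (germ_dom (repr a))) x)
       (fs _ (germ_sec (repr a))).

Definition sheaf_natural : Prop :=
  forall (U V : opens Y) (VU : V `<=` U) (s : struct_sheaf Y U),
    fs _ (res _ VU s) =
    res _ (preimage_subset VU :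
             opens_preimage cf V `<=` opens_preimage cf U) (fs _ s).

Lemma stalk_map_germ (x : X) (U : opens Y) (Ux : oset U (f x))
    (s : struct_sheaf Y U) : sheaf_natural ->
  stalk_map (germ Ux s) = germ (Ux : oset (opens_preimage cf U) x) (fs _ s).
Proof.
move=> nat; rewrite /stalk_map.
have : \pi_(stalk (struct_sheaf Y) (f x)) (repr (germ Ux s)) = germ Ux s.
  by rewrite reprK.
case: (repr _) => A Ax a /germ_eqP[W [WA [WU [Wx e]]]] /=.
apply/germ_eqP; exists (opens_preimage cf W).
exists (preimage_subset WA), (preimage_subset WU); split=> //.
by rewrite -!nat e.
Qed.

End StalkMap.

Record smorphism (k : fieldType) (X Y : superspace k) := SMorphism {
  smor_fun :> X -> Y ;
  smor_cont : continuous smor_fun ;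
  smor_sharp : forall V : opens Y,
    superhom (struct_sheaf Y V) (struct_sheaf X (opens_preimage smor_cont V)) ;
  smor_natural : sheaf_natural smor_sharp ;
  smor_local : forall x : X, local_morphism (stalk_map smor_sharp (x := x)) ;
}.

Section FunctionSheaf.
Variables (k : fieldType) (X : topologicalType) (A : superalgType k).

Definition set_elt (U : set X) (y : X) (Uy : U y) : set_type U :=
  exist _ y (mem_set Uy).

Definition set_incl (U V : set X) (VU : V `<=` U) (y : set_type V) :
    set_type U :=
  set_elt (VU (val y) (set_valP y)).

Definition fun_res_fun (U V : opens X) (VU : V `<=` U)
    (s : set_type U -> A) : set_type V -> A := s \o set_incl VU.

Lemma fun_res_additive (U V : opens X) (VU : V `<=` U) :
  zmod_morphism (fun_res_fun VU).
Proof. by []. Qed.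

Lemma fun_res_monoid (U V : opens X) (VU : V `<=` U) :
  monoid_morphism (fun_res_fun VU).
Proof. by []. Qed.

Lemma fun_res_homog (U V : opens X) (VU : V `<=` U) b (s : set_type U -> A) :
  homog b s -> homog b (fun_res_fun VU s).
Proof. by move=> hs t; apply: hs. Qed.

Definition fun_res (U V : opens X) (VU : V `<=` U) :
    superhom (set_type U -> A) (set_type V -> A) :=
  Superhom (fun_res_additive VU) (fun_res_monoid VU) (fun=> erefl)
    (@fun_res_homog U V VU).

Lemma fun_res_id (U : opens X) (UU : U `<=` U) (s : set_type U -> A) :
  fun_res UU s = s.
Proof. by apply/funext => y; congr s; apply: val_inj. Qed.

Lemma fun_res_comp (U V W : opens X) (VU : V `<=` U) (WV : W `<=` V)
  (WU : W `<=` U) (s : set_type U -> A) :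
  fun_res WV (fun_res VU s) = fun_res WU s.
Proof. by apply/funext => y; congr s; apply: val_inj. Qed.

Definition fun_presheaf : presheaf k X := Presheaf fun_res_id fun_res_comp.

Lemma fun_presheafP : is_sheaf fun_presheaf.
Proof.
move=> I U V VU cover s compat.
have cov (y : set_type U) : {i | oset (V i) (val y)}.
  by apply: cid; have [i _ Viy] := cover _ (set_valP y); exists i.
pose t (y : set_type U) : A :=
  s (projT1 (cov y)) (@set_elt (V (projT1 (cov y))) _ (projT2 (cov y))).
have tE i : fun_res (VU i) t = s i.
  apply/funext => y; rewrite /= /fun_res_fun /= /t.
  set z := set_incl _ y; case: (cov z) => j Vjz /=.
  have Vij : oset (opensI (V i) (V j)) (val y).
    by split; [exact: set_valP|exact: Vjz].
  have /(congr1 (fun g : set_type (opensI (V i) (V j)) -> A =>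
    g (set_elt Vij))) := compat i j.
  rewrite /= /fun_res_fun /=.
  have -> : set_incl (@opensIl _ (V i) (V j)) (set_elt Vij) = y.
    exact: val_inj.
  by move=> ->; congr (s j); apply: val_inj.
exists t; split=> // t' t'E; apply/funext => y.
have [i _ Viy] := cover _ (set_valP y).
have := congr1 (fun g : set_type (V i) -> A => g (@set_elt (V i) _ Viy))
  (etrans (tE i) (esym (t'E i))).
rewrite /= /fun_res_fun /=.
by have -> : set_incl (VU i) (@set_elt (V i) _ Viy) = y by exact: val_inj.
Qed.

End FunctionSheaf.

Section Pt.
Variables (k : fieldType) (q : nat).

Definition pt_carrier : topologicalType := discrete_topology unit.
Definition pt_point : pt_carrier := tt.

(* The sections over U are the functions from U to the Grassmann algebra: this
   is the Grassmann algebra itself if U is the point, and 0 if U is empty. *)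
Definition pt_sheaf : presheaf k pt_carrier :=
  fun_presheaf pt_carrier (grassmann k q).

Definition pt_base (U : opens pt_carrier) (Ux : oset U pt_point) : set_type U :=
  set_elt Ux.

Lemma pt_baseP (U : opens pt_carrier) (Ux : oset U pt_point) (y : set_type U) :
  y = pt_base Ux.
Proof. by apply: val_inj; case: (val y); case: (val (pt_base Ux)). Qed.

Definition pt_eval (a : stalk pt_sheaf pt_point) : grassmann k q :=
  germ_sec (repr a) (pt_base (germ_mem (repr a))).

Lemma pt_eval_germ (U : opens pt_carrier) (Ux : oset U pt_point)
  (s : pt_sheaf U) : pt_eval (germ Ux s) = s (pt_base Ux).
Proof.
rewrite /pt_eval.
have : \pi_(stalk pt_sheaf pt_point) (repr (germ Ux s)) = germ Ux s.
  by rewrite reprK.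
case: (repr _) => V Vx t /germ_eqP[W [WV [WU [Wx e]]]] /=.
have := congr1 (fun g : set_type W -> _ => g (pt_base Wx)) e.
rewrite /= /fun_res_fun /=.
by rewrite (pt_baseP Vx (set_incl WV _)) (pt_baseP Ux (set_incl WU _)).
Qed.

Lemma pt_eval_additive : zmod_morphism pt_eval.
Proof.
move=> a b; have [U [Ux [s [t [-> ->]]]]] := stalkP2 a b.
by rewrite -germN -germD !pt_eval_germ.
Qed.

Lemma pt_eval_monoid : monoid_morphism pt_eval.
Proof.
split.
  by rewrite -(germ1 _ (I : oset (opensT pt_carrier) pt_point)) pt_eval_germ.
move=> a b; have [U [Ux [s [t [-> ->]]]]] := stalkP2 a b.
by rewrite -germM !pt_eval_germ.
Qed.

Lemma pt_eval_sconst c : pt_eval (sconst c) = sconst c.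
Proof.
rewrite -(germ_sconst _ c (I : oset (opensT pt_carrier) pt_point)).
by rewrite pt_eval_germ.
Qed.

Lemma pt_eval_homog b a : homog b a -> homog b (pt_eval a).
Proof. by move=> [U [Ux [s [hs ->]]]]; rewrite pt_eval_germ; apply: hs. Qed.

Definition pt_eval_hom : superhom (stalk pt_sheaf pt_point) (grassmann k q) :=
  Superhom pt_eval_additive pt_eval_monoid pt_eval_sconst pt_eval_homog.

Section Sections.
Variables (U : opens pt_carrier) (Ux : oset U pt_point).

Definition pt_cst_hom : superhom (grassmann k q) (pt_sheaf U).
Proof.
refine (@Superhom k (grassmann k q) (pt_sheaf U) (fun g _ => g) _ _ _ _) => //.
by move=> b g hg y; exact: hg.
Defined.

Definition pt_ev_hom : superhom (pt_sheaf U) (grassmann k q).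
Proof.
by refine (@Superhom k (pt_sheaf U) (grassmann k q)
  (fun s => s (pt_base Ux)) _ _ _ _).
Defined.

Lemma pt_section_iso :
  cancel pt_cst_hom pt_ev_hom /\ cancel pt_ev_hom pt_cst_hom.
Proof.
split=> // s; apply/funext => y /=.
by rewrite [y](pt_baseP Ux).
Qed.
End Sections.

Definition pt_germ_hom : superhom (grassmann k q) (stalk pt_sheaf pt_point).
Proof.
pose Tx : oset (opensT pt_carrier) pt_point := I.
refine (@Superhom k (grassmann k q) (stalk pt_sheaf pt_point)
  (fun g => germ Tx (pt_cst_hom _ g)) _ _ _ _).
- by move=> a b; rewrite raddfB germD germN.
- split; first by rewrite rmorph1 germ1.
  by move=> a b; rewrite rmorphM germM.
- by move=> c; rewrite superhom_sconst germ_sconst.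
- move=> b a ha; exists (opensT pt_carrier), Tx, (pt_cst_hom _ a).
  by split=> //; apply: superhom_homog.
Defined.

Lemma pt_stalk_iso :
  cancel pt_germ_hom pt_eval_hom /\ cancel pt_eval_hom pt_germ_hom.
Proof.
split=> [a|a]; first by rewrite /= pt_eval_germ.
have [U [Ux [s ->]]] := stalkP a; rewrite /= pt_eval_germ.
apply/germ_eqP; exists U, (@subsetT _ U), (@subset_refl _ _); split=> //.
rewrite res_id; apply/funext => y.
by rewrite [y](pt_baseP Ux).
Qed.

Lemma pt_section_local (U : opens pt_carrier) :
  U !=set0 -> local_supercommutative (pt_sheaf U).
Proof.
move=> [[] Ux]; split; last first.
  have [h1 h2] := pt_section_iso Ux.
  exact: local_superalgebra_iso h1 h2 (grassmann_local k q).
move=> a b f g hf hg; apply/funext => y.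
rewrite [LHS](grassmann_supercommutative (hf y) (hg y)).
by case: (a && b); rewrite ?expr0 ?expr1 ?mul1r ?mulN1r.
Qed.

Lemma pt_stalk_local (x : pt_carrier) :
  local_supercommutative (stalk pt_sheaf x).
Proof.
case: x; have [h1 h2] := pt_stalk_iso; split; last first.
  exact: local_superalgebra_iso h1 h2 (grassmann_local k q).
move=> a b f g hf hg; rewrite -[LHS]h2 -[RHS]h2; congr (pt_germ_hom _).
rewrite !rmorphM rmorphXn rmorphN rmorph1.
exact: grassmann_supercommutative (superhom_homog _ hf) (superhom_homog _ hg).
Qed.

Definition pt : superspace k :=
  Superspace (@fun_presheafP _ _ _) pt_section_local pt_stalk_local.

End Pt.
Arguments pt_eval {k q}.

Definition qpoint (k : fieldType) (q : nat) (X : superspace k) : Type :=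
  smorphism (pt k q) X.

Section Points.
Variables (k : fieldType) (q : nat) (X : superspace k).

Definition qpoint_base (x : qpoint q X) : X := x pt_point.

Definition qpoint_sharp (x : qpoint q X)
    (a : stalk (struct_sheaf X) (qpoint_base x)) : grassmann k q :=
  pt_eval (stalk_map (smor_sharp x) a).

(* The q-points of the open subspace (U, S|_U), as q-points of X. *)
Definition qpoints_in (U : opens X) : set (qpoint q X) :=
  [set x | oset U (qpoint_base x)].

Definition qpoint_value (U : opens X) (f : struct_sheaf X U)
    (x : set_type (qpoints_in U)) : grassmann k q :=
  qpoint_sharp (germ (set_valP x : oset U (qpoint_base (val x))) f).

End Points.

Record topology_on (T : Type) := TopologyOn {
  top_open :> set (set T) ;
  top_openT : top_open setT ;
  top_openI : setI_closed top_open ;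
  top_open_bigU : forall (I : Type) (F : I -> set T),
    (forall i, top_open (F i)) -> top_open (\bigcup_i F i) ;
}.

Definition topologized (T : Type) (tau : topology_on T) : Type := T.

HB.instance Definition _ (T : Type) (tau : topology_on T) :=
  gen_eqMixin (topologized tau).
HB.instance Definition _ (T : Type) (tau : topology_on T) :=
  gen_choiceMixin (topologized tau).
HB.instance Definition _ (T : Type) (tau : topology_on T) :=
  isOpenTopological.Build (topologized tau) (@top_openT T tau)
    (@top_openI T tau) (@top_open_bigU T tau).

(* The product topology on the coefficients. *)
HB.instance Definition _ (k : topologicalFieldType) (q : nat) :=
  Topological.copy (grassmann k q)
    (initial_topology (fun f : grassmann k q =>
       (fun S => f S) : {ptws {set 'I_q} -> k})).

Section NaturalTopology.
Variables (k : topologicalFieldType) (q : nat) (X : superspace k).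

Definition admissible (tau : topology_on (qpoint q X)) : Prop :=
  forall (U : opens X) (f : struct_sheaf X U),
    continuous (@qpoint_value k q X U f :
      set_type (qpoints_in U : set (topologized tau)) -> grassmann k q).

(* Admissible topologies are not stable under intersection, because qpoints_in U
   need not be open, so that the coarsest one cannot be built as an intersection
   and is characterized as their least element. *)
Definition natural_topology (tau : topology_on (qpoint q X)) : Prop :=
  admissible tau /\ forall tau', admissible tau' -> tau `<=` tau'.

End NaturalTopology.

Definition trivial_odd_sector (k : fieldType) (X : superspace k) : Prop :=
  forall (q : nat) (x : qpoint q X),
    range (@qpoint_sharp k q X x) `&` homog true = [set 0].

(* Main.v *)
Require Import Defs.
From mathcomp Require Import all_boot all_order all_algebra.
From mathcomp Require Import all_classical topology tvs.
From mathcomp Require Import ring.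

Set Implicit Arguments.
Unset Strict Implicit.
Unset Printing Implicit Defensive.

(** Suppose that some q-point x sends some germ to a nonzero odd element. The
    contradiction comes from a line of 1-points, a copy of the noncompact
    space k.

    The line. The image B of the stalk under h, the homomorphism to the
    Grassmann algebra given by x, is k + m with m nilpotent, so that an odd
    part of B which is not zero is not m_0 m_1 either. A functional on B_1
    that vanishes on m_0 m_1 yields a homomorphism from B to the Grassmann
    algebra with one generator e. Such a functional needs no linear algebra:
    take the coefficient of e_S, where S has the least odd cardinality among
    the index sets at which an element of B has a nonzero coefficient
    ([leading_coeff_exists]). A decomposition of S into two nonempty parts has
    a part of smaller odd cardinality, so that the coefficient at S obeys a
    Leibniz rule ([leading_coeffM]) and can be rescaled freely:
    a |-> body(h a) + t (h a)_S e is a homomorphism for each t in k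
    ([deform]). A homomorphism from a local superalgebra to a Grassmann
    algebra is automatically local ([maximal_graded_ideal_bodyE]), hence gives
    a 1-point c(t) ([stalk_point]).

    Compactness. An infinite topological field is not compact
    ([infinite_topological_field_not_compact]), so k carries a proper filter F
    without cluster points. If the 1-points are compact, c(F) has a cluster
    point p. The base point of p may lie outside the open set on which a given
    section is defined, and then continuity of that section says nothing about
    p. It does imply that p and c(0) give the same values to all the sections
    that both can evaluate: such a section takes on c(t) the value u + t v e
    with u and v fixed, and F has no cluster point, whence v = 0 and the value
    at p is u. Then the topology whose open sets are those that contain p as
    soon as they contain c(0) makes all sections continuous
    ([specialization_admissible]), and the natural topology, being the
    coarsest one, is coarser: every neighbourhood of c(0) contains p.
    Therefore c(0) is a cluster point of c(F) as well. Now a section f near the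
    base point of x with (h f)_S <> 0 takes on c(t) a value whose coefficient
    at e is t (h f)_S, and its continuity makes 0 a cluster point of F. *)

Import GRing.Theory.
Local Open Scope ring_scope.

(** * Infinite topological fields are not compact *)

Section NonCompactness.
Local Open Scope classical_set_scope.

(** A cluster point of the cofinite filter cannot be isolated. *)
Lemma infinite_discrete_not_compact (T : topologicalType) :
  (forall x : T, open [set x]) -> infinite_set [set: T] ->
  ~ compact [set: T].
Proof.
move=> dT iT cT.
pose cof : set_system T := [set A | finite_set (~` A)].
have cofF : ProperFilter cof.
  apply: Build_ProperFilter_ex.
    move=> A /= fA; apply: contrapT => nA; apply: iT; move: fA; rewrite /cof /=.
    congr finite_set; apply/seteqP; split=> // x _ Ax.
    by apply: nA; exists x.
  split; rewrite /cof /=; first by rewrite setCT; exact: finite_set0.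
    by move=> A B fA fB; rewrite /mkset setCI finite_setU.
  by move=> A B AB; apply: sub_finite_set; exact: subsetC.
have [|p [_ clp]] := cT cof cofF; first exact: filterT.
have [||x [/= xp xp']] := clp (~` [set p]) [set p].
- by rewrite /cof /= setCK; exact: finite_set1.
- exact: open_nbhs_nbhs.
- exact: xp xp'.
Qed.

(** If 0 is isolated then so is every point. Otherwise t^-1 would have a cluster
    point s as t tends to 0, and 1 = t t^-1 would be arbitrarily close to
    0 s = 0. *)
Lemma infinite_topological_field_not_compact (k : topologicalFieldType) :
  infinite_set [set: k] -> ~ compact [set: k].
Proof.
move=> ik ck.
have [o0|no0] := pselect (open [set 0 : k]).
  apply: (@infinite_discrete_not_compact k) ik ck => x.
  have -> : [set x] = (fun y : k => y - x) @^-1` [set 0].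
    apply/seteqP; split=> y /=; first by move=> ->; rewrite subrr.
    by move/eqP; rewrite subr_eq0 => /eqP.
  apply: open_comp o0 => y _.
  move=> W /(@sub_continuous k (y, x))[[A B] /= [Ay /nbhs_singleton Bx] AB].
  by apply: filterS Ay => z Az; apply: (AB (z, x)).
have d0 : ProperFilter (0 : k)^'.
  apply: Build_ProperFilter_ex.
  (* a punctured neighbourhood of 0 that is empty makes 0 isolated *)
  move=> A A0; apply: contrapT => nA; apply: no0.
  have {}A0 : nbhs (0 : k) [set y | y != 0 -> A y] := A0.
  rewrite openE => _ ->; rewrite /interior; apply: filterS A0 => y Ay.
  apply: contrapT => y0; apply: nA; exists y; apply: Ay.
  by apply/eqP => e; apply: y0.
have [|s [_ cls]] := ck ((GRing.inv : k -> k) @ (0 : k)^') _; first exact: filterT.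
have : nbhs ((0 : k) * s) [set y | y != 1].
  rewrite mul0r; have := @topfield_hausdorff k; rewrite open_hausdorff.
  move=> /(_ 0 1); rewrite eq_sym oner_neq0 => /(_ isT)[[A B]] /= [].
  rewrite !inE => A0 B1 [oA _ AB]; rewrite nbhsE; exists A => //.
  move=> y Ay; apply/eqP => y1; rewrite y1 in Ay.
  have : (A `&` B) 1 by []. by rewrite AB.
move=> /(@mulf_continuous k (0, s))[[A B] /= [A0 Bs] AB].
pose B' := (GRing.inv : k -> k) @` (A `&` [set t | t != 0]).
have B'F : ((GRing.inv : k -> k) @ (0 : k)^') B'.
  have {}A0 : nbhs (0 : k) A := A0.
  by apply: filterS A0 => t At t0; exists t.
have [_ [[t [At t0] <-] Bt]] := cls B' B B'F Bs.
by have := AB (t, t^-1) (conj At Bt); rewrite /= mulfV // eqxx.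
Qed.

End NonCompactness.

(** * Deforming a homomorphism to a Grassmann algebra *)

Section GrassmannCoefficients.
Variables (k : fieldType) (q : nat).
Implicit Types (f g : grassmann k q) (S A B : {set 'I_q}).

Lemma grmul_coeff_indecomposable f g S : S != finset.set0 ->
  (forall A B, A :|: B = S -> [disjoint A & B] -> A != finset.set0 ->
     B != finset.set0 -> f A * g B = 0) ->
  (f * g) S = grbody f * g S + f S * grbody g.
Proof.
move=> S0 H; rewrite [LHS]grmulE.
have zero A B : A != finset.set0 -> B != finset.set0 ->
    (A :|: B == S)%:R * (grsign k A B * f A * g B) = 0.
  move=> A0 B0; case: eqP => [ABS|_]; last by rewrite mul0r.
  rewrite /grsign; case: ifP => dAB; last by rewrite !mul0r mulr0.
  by rewrite -mulrA H // !mulr0.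
rewrite (bigD1 finset.set0) //=; congr (_ + _).
  rewrite (bigD1 S) //= big1 ?addr0; last first.
    by move=> B /negPf BS; rewrite finset.set0U BS mul0r.
  by rewrite finset.set0U eqxx grsign0l !mul1r.
rewrite (bigD1 S) //= [X in _ + X]big1 ?addr0; last first.
  move=> A /andP[A0 AS]; rewrite (bigD1 finset.set0) //= big1 ?addr0; last first.
    by move=> B; apply: zero.
  by rewrite finset.setU0 (negPf AS) mul0r.
rewrite (bigD1 finset.set0) //= big1 ?addr0; last by move=> B; apply: zero.
by rewrite finset.setU0 eqxx grsign0r !mul1r.
Qed.

Lemma grcoeffB f g S : (f - g) S = f S - g S.
Proof. by rewrite !ffunE. Qed.

Lemma grassmann_neq0 f : homog true f -> f != 0 ->
  exists2 S : {set 'I_q}, odd #|S| & f S != 0.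
Proof.
move=> hf f0; apply: contrapT => nS; move/eqP: f0; apply.
apply/ffunP => S; rewrite ffunE; apply/eqP/negPn/negP => fS.
by apply: nS; exists S => //; apply: contrapT => /negP oS; move/eqP: fS; apply;
  apply: hf; rewrite (negPf oS).
Qed.

End GrassmannCoefficients.

Section Deformation.
Variables (k : fieldType) (q : nat) (A : superalgType k).
Variables (h : superhom A (grassmann k q)) (S : {set 'I_q}).
Hypothesis oddS : odd #|S|.
Hypothesis minS : forall a (T : {set 'I_q}),
  odd #|T| -> (#|T| < #|S|)%N -> h a T = 0.

(** This is body(h a) + t (h a)_S e, where e is the generator: the full set is
    the only nonempty subset of 'I_1. *)
Definition deform_fun (t : k) (a : A) : grassmann k 1 :=
  [ffun T => if T == finset.set0 then grbody (h a) else t * h a S].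

Let S0 : S != finset.set0.
Proof. by apply: contraTneq oddS => ->; rewrite cards0. Qed.

(** Of two complementary nonempty parts of S, one has odd cardinality, less than
    that of S, so that its coefficients vanish. *)
Lemma leading_coeffM (a b : A) :
  h (a * b) S = grbody (h a) * h b S + h a S * grbody (h b).
Proof.
rewrite rmorphM; apply: grmul_coeff_indecomposable => // B C BCS dBC B0 C0.
have cS : #|S| = (#|B| + #|C|)%N.
  by rewrite -BCS cardsU disjoint_setI0 // cards0 subn0.
have cB : (0 < #|B|)%N by rewrite card_gt0.
have cC : (0 < #|C|)%N by rewrite card_gt0.
have [oB|eB] := boolP (odd #|B|).
  by rewrite minS ?mul0r // cS -[X in (X < _)%N]addn0 ltn_add2l.
rewrite (@minS b C) ?mulr0 //; last by rewrite cS -[X in (X < _)%N]add0n ltn_add2r.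
by move: oddS; rewrite cS oddD (negPf eB).
Qed.

Lemma deform_body t a : grbody (deform_fun t a) = grbody (h a).
Proof. by rewrite /grbody ffunE eqxx. Qed.

Lemma deform_coeff t a T : T != finset.set0 -> deform_fun t a T = t * h a S.
Proof. by move=> /negPf T0; rewrite ffunE T0. Qed.

Lemma deform_additive t : zmod_morphism (deform_fun t).
Proof.
move=> a b; apply/ffunP => T; rewrite grcoeffB !ffunE raddfB.
by case: ifP => _; rewrite ?grbodyB // grcoeffB mulrBr.
Qed.

Lemma deform_sconst t c : deform_fun t (sconst c) = sconst c.
Proof.
apply/ffunP => T; rewrite ffunE superhom_sconst /grbody !ffunE eqxx (negPf S0) mulr0.
by [].
Qed.

Lemma deform_monoid t : monoid_morphism (deform_fun t).
Proof.
split; first by have := deform_sconst t 1; rewrite !rmorph1.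
move=> a b; apply/ffunP => T.
have [->|T0] := eqVneq T finset.set0.
  by rewrite -!/(grbody _) grbodyM !deform_body rmorphM grbodyM.
rewrite grmul_coeff_indecomposable // => [|B C _ dBC B0 C0].
  by rewrite !deform_body !deform_coeff // leading_coeffM; ring.
(* nonempty subsets of 'I_1 are not disjoint *)
have full (D : {set 'I_1}) : D != finset.set0 -> ord0 \in D.
  by move=> /set0Pn[i]; rewrite (ord1 i).
by have := disjointFr dBC (full _ B0); rewrite full.
Qed.

Lemma deform_homog t b a : homog b a -> homog b (deform_fun t a).
Proof.
move=> /(superhom_homog h) ha T oT; rewrite /deform_fun ffunE.
case: (eqVneq T finset.set0) oT => [->|T0] oT.
  by apply: ha; move: oT; rewrite !cards0.
have T1 : #|T| = 1%N.
  apply/eqP; rewrite eqn_leq card_gt0 T0 andbT.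
  by rewrite -[X in (_ <= X)%N](card_ord 1) max_card.
have -> : h a S = 0 by apply: ha; move: oT; rewrite oddS T1.
by rewrite mulr0.
Qed.

Definition deform (t : k) : superhom A (grassmann k 1) :=
  Superhom (deform_additive t) (deform_monoid t) (deform_sconst t)
    (@deform_homog t).

End Deformation.

(** * From homomorphisms on stalks to points *)

Section Locality.
Local Open Scope classical_set_scope.
Variables (k : fieldType) (q : nat) (A : superalgType k).
Variable h : superhom A (grassmann k q).

(** The quotient by this ideal is k: each element differs from a scalar by an
    element of the ideal. *)
Lemma maximal_graded_ideal_body :
  maximal_graded_ideal [set a | grbody (h a) = 0].
Proof.
have body0 : grbody (0 : grassmann k q) = 0 by rewrite /grbody ffunE.
have h1 : grbody (h 1) = 1 by rewrite rmorph1 grbody1.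
split; first split.
- split=> /=; first by rewrite raddf0.
  + by move=> a b ha hb; rewrite raddfD /grbody ffunE [h a _]ha [h b _]hb addr0.
  + by move=> a b hb; rewrite rmorphM grbodyM hb mulr0.
  + by move=> a b hb; rewrite rmorphM grbodyM hb mul0r.
  + move=> a b ha hb; rewrite raddfD.
    have b0 : grbody (h b) = 0.
      by apply: (superhom_homog h hb); rewrite cards0.
    by rewrite /grbody ffunE [h b _]b0 addr0.
- apply/eqP => /seteqP[_ /(_ 1 I)] /=; rewrite h1 => /eqP.
  by rewrite oner_eq0.
move=> I [[I0 ID Il _ _] /eqP IT] PI; apply/seteqP; split=> // a Ia /=.
apply: contrapT => /eqP ca; apply: IT.
set c := grbody (h a) in ca.
have Ic : I (sconst c).
  rewrite -[sconst c](addrNK a); apply: ID => //; apply: PI => /=.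
  by rewrite raddfB /= superhom_sconst grbodyB /grbody ffunE eqxx subrr.
apply/seteqP; split=> // b _.
rewrite -[b]mulr1 -(rmorph1 (@sconst k A)) -(mulVf ca) rmorphM mulrA.
exact: Il.
Qed.

(** Since h is arbitrary here, every homomorphism from a local superalgebra to a
    Grassmann algebra is local. *)
Lemma maximal_graded_ideal_bodyE (M : set A) :
  local_superalgebra A -> maximal_graded_ideal M ->
  M = [set a | grbody (h a) = 0].
Proof.
move=> [N [_ Nuniq]] /Nuniq <-; symmetry.
by rewrite -(Nuniq _ maximal_graded_ideal_body).
Qed.

End Locality.

Section PointOfStalk.
Local Open Scope classical_set_scope.
Variables (k : fieldType) (q : nat) (X : superspace k) (x : X).
Variable h : superhom (stalk (struct_sheaf X) x) (grassmann k q).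

Let base (_ : pt k q) : X := x.

Let base_continuous : continuous base.
Proof. by move=> y; exact: cst_continuous. Qed.

Definition stalk_point_sharp_fun (V : opens X) (s : struct_sheaf X V) :
    struct_sheaf (pt k q) (opens_preimage base_continuous V) :=
  fun y => h (germ (set_valP y : oset V x) s).

Lemma stalk_point_additive V : zmod_morphism (@stalk_point_sharp_fun V).
Proof.
by move=> a b; apply/funext => y; rewrite /stalk_point_sharp_fun germD germN raddfB.
Qed.

Lemma stalk_point_monoid V : monoid_morphism (@stalk_point_sharp_fun V).
Proof.
split; first by apply/funext => y; rewrite /stalk_point_sharp_fun germ1 rmorph1.
by move=> a b; apply/funext => y; rewrite /stalk_point_sharp_fun germM rmorphM.
Qed.

Lemma stalk_point_sconst V c :
  @stalk_point_sharp_fun V (sconst c) = sconst c.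
Proof.
by apply/funext => y; rewrite /stalk_point_sharp_fun germ_sconst superhom_sconst.
Qed.

Lemma stalk_point_homog V b (a : struct_sheaf X V) :
  homog b a -> homog b (stalk_point_sharp_fun a).
Proof.
by move=> ha y; apply: superhom_homog; exists V, (set_valP y : oset V x), a.
Qed.

Definition stalk_point_sharp (V : opens X) :
    superhom (struct_sheaf X V)
      (struct_sheaf (pt k q) (opens_preimage base_continuous V)) :=
  Superhom (@stalk_point_additive V) (@stalk_point_monoid V)
    (@stalk_point_sconst V) (@stalk_point_homog V).

Lemma stalk_point_natural : sheaf_natural stalk_point_sharp.
Proof.
move=> U V VU s; apply/funext => y.
by rewrite /= /fun_res_fun /= /stalk_point_sharp_fun; congr (h _); exact: germ_res.
Qed.

(** The stalk map of the point under construction is h, up to the identification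
    of the stalk of the source with the Grassmann algebra. *)
Lemma pt_eval_stalk_point (a : stalk (struct_sheaf X) (base pt_point)) :
  pt_eval (stalk_map stalk_point_sharp (x := pt_point) a) = h a.
Proof.
have [U [Ux [s ->]]] := stalkP a.
rewrite (stalk_map_germ _ _ stalk_point_natural) pt_eval_germ /=.
by rewrite /stalk_point_sharp_fun; congr (h (germ _ _)); exact: Prop_irrelevance.
Qed.

Lemma stalk_point_local (y : pt k q) :
  local_morphism (stalk_map stalk_point_sharp (x := y)).
Proof.
case: y => M N /(maximal_graded_ideal_bodyE h (stalk_local x).2) ->.
move=> /(maximal_graded_ideal_bodyE (@pt_eval_hom k q) (pt_stalk_local k q tt).2) ->.
by move=> _ [a /= ha <-]; rewrite pt_eval_stalk_point.
Qed.

Definition stalk_point : qpoint q X :=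
  SMorphism stalk_point_natural stalk_point_local.

Lemma qpoint_sharp_stalk_point a : qpoint_sharp (x := stalk_point) a = h a.
Proof. exact: pt_eval_stalk_point. Qed.

End PointOfStalk.

Section SharpSuperhom.
Variables (k : fieldType) (q : nat) (X : superspace k) (x : qpoint q X).

Lemma qpoint_sharpE (U : opens X) (Ux : oset U (qpoint_base x))
    (s : struct_sheaf X U) :
  qpoint_sharp (germ Ux s) =
  smor_sharp x U s (@pt_base (opens_preimage (@smor_cont _ _ _ x) U) Ux).
Proof.
by rewrite /qpoint_sharp (stalk_map_germ _ _ (@smor_natural _ _ _ x)) pt_eval_germ.
Qed.

Lemma qpoint_sharp_additive : zmod_morphism (@qpoint_sharp k q X x).
Proof.
move=> a b; have [U [Ux [s [t [-> ->]]]]] := stalkP2 a b.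
by rewrite -germN -germD !qpoint_sharpE raddfB.
Qed.

Lemma qpoint_sharp_monoid : monoid_morphism (@qpoint_sharp k q X x).
Proof.
split.
  rewrite -(germ1 (struct_sheaf X) (opensT_mem (qpoint_base x))).
  by rewrite qpoint_sharpE rmorph1.
move=> a b; have [U [Ux [s [t [-> ->]]]]] := stalkP2 a b.
by rewrite -germM !qpoint_sharpE rmorphM.
Qed.

Lemma qpoint_sharp_sconst c : qpoint_sharp (x := x) (sconst c) = sconst c.
Proof.
rewrite -(germ_sconst (struct_sheaf X) c (opensT_mem (qpoint_base x))).
by rewrite qpoint_sharpE superhom_sconst.
Qed.

Lemma qpoint_sharp_homog b a :
  homog b a -> homog b (qpoint_sharp (x := x) a).
Proof.
move=> [U [Ux [s [hs ->]]]]; rewrite qpoint_sharpE.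
exact: (superhom_homog (smor_sharp x U) hs (pt_base _)).
Qed.

Definition qpoint_sharp_hom :
    superhom (stalk (struct_sheaf X) (qpoint_base x)) (grassmann k q) :=
  Superhom qpoint_sharp_additive qpoint_sharp_monoid qpoint_sharp_sconst
    qpoint_sharp_homog.

End SharpSuperhom.

(** * Cluster points in the natural topology *)

Section NaturalTopologyPoints.
Local Open Scope classical_set_scope.
Variables (k : topologicalFieldType) (q : nat) (X : superspace k).
Implicit Types (tau : topology_on (qpoint q X)) (p : qpoint q X).

Lemma grcoeff_continuous (S : {set 'I_q}) :
  continuous (fun f : grassmann k q => f S : k).
Proof.
move=> f; apply: (@continuous_comp _ _ _ (fun f : grassmann k q =>
  (fun T => f T) : {ptws {set 'I_q} -> k})
  (fun g : {ptws {set 'I_q} -> k} => g S)).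
  exact: (@initial_continuous _ _ (fun f : grassmann k q =>
       (fun S => f S) : {ptws {set 'I_q} -> k})).
exact: (@proj_continuous _ (fun=> k) S).
Qed.

(** Continuity of the section f in a form that avoids the subspace topology. The
    trace of V on the points based in U is determined; outside U nothing is
    known of V. *)
Lemma admissible_coeff_open tau (U : opens X) (f : struct_sheaf X U)
    (S : {set 'I_q}) (O : set k) :
  admissible tau -> open O ->
  exists2 V, top_open tau V & forall p (Up : oset U (qpoint_base p)),
    V p <-> O (qpoint_sharp (germ Up f) S).
Proof.
move=> adm oO.
have : open ((fun g : grassmann k q => g S : k) @^-1` O).
  by apply: open_comp oO => g _; exact: grcoeff_continuous.
move=> oO'; have := open_comp (fun x _ => adm U f x) oO'.
move=> [V oV eV]; exists V; first exact: oV.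
move=> p Up; pose y : set_type (qpoints_in U) := exist _ p (mem_set Up).
have := congr1 (fun W : set (set_type (qpoints_in U)) => W y) eV.
rewrite /= /preimage /= /qpoint_value.
have -> : set_valP y = Up by exact: Prop_irrelevance.
by move=> ->.
Qed.

Lemma admissible_cluster tau (U : opens X) (f : struct_sheaf X U)
    (S : {set 'I_q}) (T : Type) (F : set_system T) (c : T -> qpoint q X)
    (p : qpoint q X) (Up : oset U (qpoint_base p))
    (Uc : forall t, oset U (qpoint_base (c t))) :
  admissible tau -> Filter F -> cluster ((c : T -> topologized tau) @ F) p ->
  cluster ((fun t => qpoint_sharp (germ (Uc t) f) S) @ F)
    (qpoint_sharp (germ Up f) S).
Proof.
move=> adm FF clp A B FA; rewrite nbhsE => -[O [oO Op] OB].
have [V oV VE] := admissible_coeff_open f S adm oO.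
pose g t := qpoint_sharp (germ (Uc t) f) S.
have FcA : ((c : T -> topologized tau) @ F) (c @` (g @^-1` A)).
  by apply: (@filterS _ F _ (g @^-1` A)) => // t At; exists t.
have Vp : nbhs (p : topologized tau) V.
  by apply: open_nbhs_nbhs; split; [exact: oV|apply/VE].
have [_ [[t At <-] Vt]] := clp _ V FcA Vp.
by exists (g t); split=> //; apply/OB/VE.
Qed.

(** The finest topology for which p lies in the closure of p'. *)
Definition specialization_topology (p p' : qpoint q X) : topology_on (qpoint q X).
Proof.
refine (@TopologyOn _ [set V | V p -> V p'] _ _ _) => //.
- by move=> V W hV hW [Vp Wp]; split; [exact: hV|exact: hW].
- by move=> I F hF [i _ Fp]; exists i => //; exact: hF.
Defined.

(** If p' is not based in U, then adding p' to a set of points based in U makes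
    it open without changing its trace on U. If p' is based in U, then such a
    set is open unless it separates p from p', which preimages under sections
    do not. *)
Lemma specialization_admissible p p' :
  (forall (U : opens X) (f : struct_sheaf X U)
     (Up : oset U (qpoint_base p)) (Up' : oset U (qpoint_base p')),
     qpoint_sharp (germ Up f) = qpoint_sharp (germ Up' f)) ->
  admissible (specialization_topology p p').
Proof.
move=> same U f; apply/continuousP => O _.
pose P : set (qpoint q X) :=
  [set r | (exists Ur : oset U (qpoint_base r), O (qpoint_sharp (germ Ur f))) \/
     r = p' /\ ~ oset U (qpoint_base p')].
have PP : P p -> P p'.
  move=> [[Up Op]|[_ nU]]; last by right.
  have [Up'|nU] := pselect (oset U (qpoint_base p')); last by right.
  by left; exists Up'; rewrite -(same _ _ Up).
exists P; first exact: PP.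
apply/seteqP; split=> r; rewrite /preimage /= /P /qpoint_value /=.
  move=> [[Ur Or]|[rp' nU]]; last by case: nU; rewrite -rp'; exact: (set_valP r).
  by rewrite (_ : set_valP r = Ur) //; exact: Prop_irrelevance.
by move=> Or; left; exists (set_valP r).
Qed.

Lemma natural_topology_specialization tau p p' : natural_topology tau ->
  (forall (U : opens X) (f : struct_sheaf X U)
     (Up : oset U (qpoint_base p)) (Up' : oset U (qpoint_base p')),
     qpoint_sharp (germ Up f) = qpoint_sharp (germ Up' f)) ->
  forall V, top_open tau V -> V p -> V p'.
Proof. by move=> [_ least] /specialization_admissible /least. Qed.

End NaturalTopologyPoints.

Section ClusterPoints.
Local Open Scope classical_set_scope.
Variables (k : topologicalFieldType) (F : set_system k).
Hypothesis FF : ProperFilter F.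

Lemma cluster_cst (v w : k) : cluster ((fun=> v) @ F) w -> v = w.
Proof.
move=> clw; apply: (@topfield_hausdorff k) => A B Av Bw.
apply: (clw A B _ Bw).
by apply: (@filterS _ F _ setT); [move=> t _ /=; exact: nbhs_singleton|exact: filterT].
Qed.

Lemma cluster_mulr (b w : k) : b != 0 ->
  cluster ((fun t => t * b) @ F) w -> cluster F (w / b).
Proof.
move=> b0 clw A B FA /(@mulf_continuous k (w, b^-1))[[C D] /= [Cw Db] CD].
have FbA : ((fun t => t * b) @ F) ((fun t => t * b) @` A).
  by apply: (@filterS _ F _ A) => // t At; exists t.
have [_ [[t At <-] Ct]] := clw _ _ FbA Cw.
exists t; split=> //; have := CD (t * b, b^-1) (conj Ct (nbhs_singleton Db)).
by rewrite /= mulfK.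
Qed.

End ClusterPoints.

(** * Triviality of the odd sector *)

Lemma leading_coeff_exists (k : fieldType) (q : nat) (A : superalgType k)
    (h : superhom A (grassmann k q)) (a : A) :
  homog true (h a) -> h a != 0 ->
  exists S : {set 'I_q}, [/\ odd #|S|, exists b, h b S != 0 &
    forall b (T : {set 'I_q}), odd #|T| -> (#|T| < #|S|)%N -> h b T = 0].
Proof.
move=> ha a0; have [S oS hS] := grassmann_neq0 ha a0.
pose P n := `[< exists (T : {set 'I_q}) b, [/\ odd #|T|, #|T| = n & h b T != 0] >].
have exP : exists n, P n by exists #|S|; apply/asboolP; exists S, a.
case: (ex_minnP exP) => n /asboolP[T [b [oT Tn bT]]] minn.
exists T; split=> // [|c V oV ltVT]; first by exists b.
apply/eqP/negPn/negP => cV; move: ltVT; rewrite Tn ltnNge => /negP; apply.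
by apply: minn; apply/asboolP; exists V, c.
Qed.

Local Open Scope classical_set_scope.

Theorem theorem7p4 (k : topologicalFieldType) (k_infinite : infinite_set [set: k])
    (X : superspace k) (tau : topology_on (qpoint 1 X))
    (tau_natural : natural_topology tau)
    (tau_compact : compact [set: topologized tau]) :
  trivial_odd_sector X.
Proof.
move=> q x; apply/seteqP; split; last first.
  move=> _ ->; split; last exact: homog0.
  by exists 0 => //; exact: (raddf0 (qpoint_sharp_hom x)).
move=> _ [[a _ <-] odda]; apply: contrapT => /eqP a0.
pose h := qpoint_sharp_hom x.
have [S [oddS [b bS] minS]] := @leading_coeff_exists _ _ _ h a odda a0.
pose c t : qpoint 1 X := stalk_point (deform oddS minS t).
have [F FF Fcl] : exists2 F : set_system k, ProperFilter F & cluster F = set0.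
  apply: contrapT => nF; apply: (infinite_topological_field_not_compact k_infinite).
  move=> F FF _; apply: contrapT => clF; apply: nF; exists F => //.
  by apply/seteqP; split=> // y Fy; apply: clF; exists y.
have noF y : ~ cluster F y by rewrite Fcl.
have adm := tau_natural.1.
have [|p [_ clp]] := tau_compact ((c : k -> topologized tau) @ F) _.
  exact: filterT.
(* A section takes on c t the value u + t v e; F has no cluster point, so that
   v = 0, and u is the value at p by separation. *)
have same (U : opens X) (f : struct_sheaf X U) (U0 : oset U (qpoint_base (c 0)))
    (Up : oset U (qpoint_base p)) :
    qpoint_sharp (germ U0 f) = qpoint_sharp (germ Up f).
  apply/ffunP => T.
  have := @admissible_cluster k 1 X tau U f T k F c p Up (fun=> U0) adm FF clp.
  rewrite (_ : (fun t => _) = (fun t => deform oddS minS t (germ U0 f) T)); last first.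
    by apply/funext => t; rewrite qpoint_sharp_stalk_point.
  rewrite qpoint_sharp_stalk_point.
  have [->|T0] := eqVneq T finset.set0.
    under eq_fun do rewrite ffunE eqxx.
    by rewrite ffunE eqxx => /(cluster_cst FF).
  under eq_fun do rewrite deform_coeff //.
  rewrite deform_coeff // mul0r.
  have [->|g0] := eqVneq (h (germ U0 f) S) 0.
    under eq_fun do rewrite mulr0.
    by move=> /(cluster_cst FF).
  by move=> /(cluster_mulr FF g0)/noF.
(* p lies in every neighbourhood of c 0, by minimality of tau *)
have clc : cluster ((c : k -> topologized tau) @ F) (c 0).
  move=> A B FA; rewrite nbhsE => -[V [oV V0] VB].
  have Vp : V p := natural_topology_specialization tau_natural same oV V0.
  have [r [Ar Vr]] := clp _ _ FA (open_nbhs_nbhs (conj oV Vp)).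
  by exists r; split=> //; exact: VB.
have [U [Ux [f bf]]] := stalkP b.
have T0 : [set: 'I_1]%SET != finset.set0.
  by rewrite -card_gt0 cardsT card_ord.
have := @admissible_cluster k 1 X tau U f [set: 'I_1]%SET k F c (c 0) Ux
  (fun=> Ux) adm FF clc.
rewrite (_ : (fun t => _) = (fun t => t * h b S)); last first.
  by apply/funext => t; rewrite qpoint_sharp_stalk_point /= deform_coeff // bf.
by move=> /(cluster_mulr FF bS)/noF.
Qed.
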